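(* Let $p\ge 6$ and let $\Sigma\in\mathbb{R}^{p\times p}$ be positive definite. Then $\Sigma\in F_{p,2}\setminus F_{p,1}$ if and only if every $6\times 6$ principal submatrix of $\Sigma$ belongs to $F_{6,2}$ and at least one $4\times 4$ principal submatrix of $\Sigma$ does not belong to $F_{4,1}$.
   Context: For integers $p\ge 1$, $m\ge 1$, $F_{p,m}=\{\Delta+\Gamma\Gamma^t : \Delta \text{ a positive definite diagonal } p\times p \text{ matrix},\ \Gamma\in\mathbb{R}^{p\times m}\}$. *)

(* Defs.v *)
From HB Require Import structures.
From mathcomp Require Import all_boot all_order all_algebra.
Set Implicit Arguments. Unset Strict Implicit. Unset Printing Implicit Defensive.
Import Order.TTheory GRing.Theory Num.Theory.
Local Open Scope ring_scope.

Definition posdef (R : realFieldType) (p : nat) (S : 'M[R]_p) : Prop :=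
  S^T = S /\ forall x : 'cV[R]_p, x != 0 -> 0 < (x^T *m S *m x) ord0 ord0.

Definition posdiag (R : realFieldType) (p : nat) (D : 'M[R]_p) : Prop :=
  (forall i j : 'I_p, i != j -> D i j = 0) /\ (forall i : 'I_p, 0 < D i i).

Definition inF (R : realFieldType) (p m : nat) (S : 'M[R]_p) : Prop :=
  exists (D : 'M[R]_p) (G : 'M[R]_(p, m)), posdiag D /\ S = D + G *m G^T.

(* Principal submatrix indexed by a strictly increasing map f : 'I_k -> 'I_p,
   i.e. by the k-subset {f 0 < ... < f (k-1)} of row/column indices. *)
Definition principal_sub (R : Type) (p k : nat) (f : 'I_k -> 'I_p)
  (S : 'M[R]_p) : 'M[R]_k := \matrix_(i < k, j < k) S (f i) (f j).

Definition strictly_incr (p k : nat) (f : 'I_k -> 'I_p) : Prop :=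
  forall i j : 'I_k, (i < j)%N -> (f i < f j)%N.

(* Main.v *)
Require Import Defs.
From HB Require Import structures.
From mathcomp Require Import all_boot all_order all_algebra.
From mathcomp Require Import ring.
From Stdlib Require Import Classical.
Import Order.TTheory GRing.Theory Num.Theory.
Local Open Scope ring_scope.

(* S lies in F_{p,m} iff there are vectors v_i in R^m with <v_i, v_j> = S_ij for i <> j
   and |v_i|^2 < S_ii, so both models reduce to fitting vectors on small index sets.

   One factor: if all 4-subsets can be fitted, all tetrads vanish.  A triangle of nonzero
   off-diagonal entries then determines all loadings up to sign; without a triangle at
   most one off-diagonal pair is nonzero.

   Two factors, some tetrad S_ac S_bd - S_ad S_bc nonzero: in every fit v_a, v_b is a
   basis, and for k outside {a,b,c,d} the coordinates of v_k = al_k v_a + be_k v_b depend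
   on S only.  The remaining freedom is in |v_a|^2, pinned by any i with al_i <> 0, and
   |v_b|^2, pinned by any j with be_j <> 0; a fit on {a,b,c,d,i,j} therefore extends.

   Two factors, all tetrads zero: two disjoint nonzero entries force a one-factor fit,
   because in every plane fit of such a, b, c, d three vectors are parallel.  Otherwise
   the nonzero entries live on at most three indices, and the other vectors can be 0. *)

(** * Factor models as vector fits on index lists *)

(** Taking a list [A] of indices of the full matrix, rather than a submatrix, lets overlapping index
    sets be compared without reindexing. The strict diagonal bound leaves a positive remainder for
    $\Delta$. *)
Definition gram_fit {R : realFieldType} {p m : nat} (S : 'M[R]_p) (A : seq 'I_p)
    (G : 'M[R]_(p, m)) : Prop :=
  (forall i j, i \in A -> j \in A -> i != j -> (G *m G^T) i j = S i j) /\
  (forall i, i \in A -> (G *m G^T) i i < S i i).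

Definition fit1 {R : realFieldType} {p : nat} (S : 'M[R]_p) (A : seq 'I_p)
    (g : 'I_p -> R) : Prop :=
  (forall i j, i \in A -> j \in A -> i != j -> g i * g j = S i j) /\
  (forall i, i \in A -> g i ^+ 2 < S i i).

Definition fit2 {R : realFieldType} {p : nat} (S : 'M[R]_p) (A : seq 'I_p)
    (x y : 'I_p -> R) : Prop :=
  (forall i j, i \in A -> j \in A -> i != j -> x i * x j + y i * y j = S i j) /\
  (forall i, i \in A -> x i ^+ 2 + y i ^+ 2 < S i i).

Lemma fit1_gram {R : realFieldType} {p : nat} (S : 'M[R]_p) (A : seq 'I_p) :
  (exists G : 'M_(p, 1), gram_fit S A G) <-> exists g, fit1 S A g.
Proof.
split=> [[G [H1 H2]]|[g [H1 H2]]].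
  exists (fun i => G i ord0); split=> [i j Ai Aj ij|i Ai].
    by rewrite -(H1 _ _ Ai Aj ij) !mxE big_ord1 mxE.
  by have := H2 _ Ai; rewrite !mxE big_ord1 mxE expr2.
exists (\matrix_(i, j) g i); split=> [i j Ai Aj ij|i Ai].
  by rewrite -(H1 _ _ Ai Aj ij) !mxE big_ord1 !mxE.
by have := H2 _ Ai; rewrite !mxE big_ord1 !mxE expr2.
Qed.

Lemma fit2_gram {R : realFieldType} {p : nat} (S : 'M[R]_p) (A : seq 'I_p) :
  (exists G : 'M_(p, 2), gram_fit S A G) <-> exists x y, fit2 S A x y.
Proof.
split=> [[G [H1 H2]]|[x [y [H1 H2]]]].
  have ord20 : widen_ord (leqnSn 1) ord0 = ord0 by apply: val_inj.
  exists (fun i => G i ord0), (fun i => G i ord_max); split=> [i j Ai Aj ij|i Ai].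
    by rewrite -(H1 _ _ Ai Aj ij) !mxE big_ord_recr big_ord1 /= !mxE ord20.
  by have := H2 _ Ai; rewrite !mxE big_ord_recr big_ord1 /= !mxE !expr2 ord20.
exists (\matrix_(i, j) if j == ord0 then x i else y i); split=> [i j Ai Aj ij|i Ai].
  by rewrite -(H1 _ _ Ai Aj ij) !mxE big_ord_recr big_ord1 /= !mxE.
by have := H2 _ Ai; rewrite !mxE big_ord_recr big_ord1 /= !mxE !expr2.
Qed.

Lemma inF_gram {R : realFieldType} {p : nat} (m : nat) (S : 'M[R]_p) :
  inF m S <-> exists G : 'M_(p, m), gram_fit S (enum 'I_p) G.
Proof.
split=> [[D [G [[D0 Dp] ->]]]|[G [H1 H2]]].
  exists G; split=> [i j _ _ ij|i _]; rewrite ?[RHS]mxE ?[ltRHS]mxE.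
    by rewrite D0 // add0r.
  by rewrite ltrDr Dp.
exists (S - G *m G^T), G; split; last by rewrite subrK.
split=> [i j ij|i]; rewrite mxE [X in _ + X]mxE.
  by rewrite H1 ?mem_enum // subrr.
by rewrite subr_gt0 H2 ?mem_enum.
Qed.

Lemma inF_sub_gram {R : realFieldType} {p k : nat} (m : nat) (S : 'M[R]_p)
    (f : 'I_k -> 'I_p) :
  injective f ->
  (inF m (principal_sub f S) <-> exists G : 'M_(p, m), gram_fit S (codom f) G).
Proof.
move=> finj; split=> [/inF_gram[G [H1 H2]]|[G [H1 H2]]].
  (* At most one [l] satisfies [f l == i]: row [f l] of [G'] is row [l] of [G], and rows outside the
     image of [f] are zero. *)
  pose G' := \matrix_(i < p, j < m) \sum_(l | f l == i) G l j.
  have GE l j : G' (f l) j = G l j.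
    by rewrite mxE (big_pred1 l) // => l'; apply: (inj_eq finj).
  have GGE i j : (G' *m G'^T) (f i) (f j) = (G *m G^T) i j.
    by rewrite !mxE; apply: eq_bigr => l _; rewrite !(mxE trmx_key) !GE.
  exists G'; split=> [_ _ /codomP[i ->] /codomP[j ->]|_ /codomP[i ->]].
    by rewrite (inj_eq finj) GGE => ij; rewrite H1 ?mem_enum // mxE.
  by rewrite GGE; have := H2 i; rewrite mem_enum [ltRHS]mxE; apply.
apply/inF_gram; exists (\matrix_(i, j) G (f i) j).
set G' := (X in gram_fit _ _ X).
have GGE i j : (G' *m G'^T) i j = (G *m G^T) (f i) (f j).
  by rewrite !mxE; apply: eq_bigr => l _; rewrite !mxE.
split=> [i j _ _ ij|i _]; rewrite GGE ?[RHS]mxE ?[ltRHS]mxE.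
  by rewrite H1 ?codom_f ?(inj_eq finj).
by rewrite H2 ?codom_f.
Qed.

(** * Covering and restricting index lists *)

Lemma strictly_incr_inj (p k : nat) (f : 'I_k -> 'I_p) : strictly_incr f -> injective f.
Proof.
move=> fi i j fij; apply: val_inj.
by case: (ltngtP i j) => // /fi; rewrite fij ltnn.
Qed.

(** Padding a short list to a set of exactly [k] indices and enumerating it in order lets principal
    submatrices of one fixed size control all smaller index lists. *)
Lemma strictly_incr_cover (p k : nat) (s : seq 'I_p) :
  (size s <= k)%N -> (k <= p)%N ->
  exists f : 'I_k -> 'I_p, strictly_incr f /\ {subset s <= codom f}.
Proof.
move=> sk kp.
have [B sB cB] : exists2 B : {set 'I_p}, [set x in s] \subset B & #|B| = k.
  have : (#|[set x in s]| <= k)%N.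
    by rewrite cardsE (leq_trans (card_size _)).
  elim: k kp {sk} => [|k IH] kp.
    by rewrite leqn0 => /eqP c0; exists [set x in s].
  rewrite leq_eqVlt => /predU1P[c0|]; first by exists [set x in s].
  rewrite ltnS => /(IH (ltnW kp))[B sB cB].
  have /card_gt0P[x] : (0 < #|~: B|)%N by rewrite cardsCs setCK card_ord cB subn_gt0.
  rewrite inE => xB; exists (x |: B); last by rewrite cardsU1 xB cB.
  exact: subset_trans sB (subsetUr _ _).
have szB : size (enum B) = k by rewrite -cardE.
have incB : sorted ltn (map val (enum B)).
  rewrite -[enum _](eq_filter (mem_enum _)) -(eq_filter (mem_map val_inj _)) -filter_map.
  by rewrite (sorted_filter ltn_trans) // unlock val_ord_enum iota_ltn_sorted.
exists (fun i => tnth (Tuple (introT eqP szB)) i); split=> [i j ij|x xs].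
  have x0 := tnth (Tuple (introT eqP szB)) i.
  rewrite !(tnth_nth x0) /= -!(nth_map _ 0%N val) ?szB //.
  by apply: (sorted_ltn_nth ltn_trans 0%N incB); rewrite ?inE ?size_map ?szB.
have xB : x \in Tuple (introT eqP szB).
  by rewrite memtE /= mem_enum (subsetP sB) ?inE.
by have /tnthP[i ->] := xB; apply: codom_f.
Qed.

Lemma fit1_subset {R : realFieldType} {p : nat} (S : 'M[R]_p) (A B : seq 'I_p) g :
  {subset A <= B} -> fit1 S B g -> fit1 S A g.
Proof. by move=> AB [H1 H2]; split=> [i j /AB ? /AB|i /AB]; [apply: H1|apply: H2]. Qed.

Lemma fit2_subset {R : realFieldType} {p : nat} (S : 'M[R]_p) (A B : seq 'I_p) x y :
  {subset A <= B} -> fit2 S B x y -> fit2 S A x y.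
Proof. by move=> AB [H1 H2]; split=> [i j /AB ? /AB|i /AB]; [apply: H1|apply: H2]. Qed.

Lemma uniq4 {T : eqType} (i j k l : T) :
  i != j -> i != k -> i != l -> j != k -> j != l -> k != l -> uniq [:: i; j; k; l].
Proof.
by move=> ij ik il jk jl kl; rewrite /= !inE !negb_or ij ik il jk jl kl.
Qed.

(** * The one-factor model *)

(** Since all orderings are allowed, for symmetric [S] this makes the products over the three
    pairings of four indices equal. *)
Definition tetrads_vanish {R : realFieldType} {p : nat} (S : 'M[R]_p) : Prop :=
  forall i j k l, uniq [:: i; j; k; l] -> S i j * S k l = S i k * S j l.

(* The other loadings are forced to be S a i / t. *)
Lemma rank1_loadings {R : realFieldType} {p : nat} (S : 'M[R]_p) (a b c : 'I_p) (t : R) :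
  S^T = S -> tetrads_vanish S -> uniq [:: a; b; c] ->
  S a b != 0 -> S a c != 0 -> S b c != 0 -> t ^+ 2 * S b c = S a b * S a c ->
  exists g : 'I_p -> R, g a = t /\ forall i j, i != j -> g i * g j = S i j.
Proof.
move=> /matrixP Ssym tet abc ab0 ac0 bc0 tE.
have sym i j : S i j = S j i by have := Ssym j i; rewrite mxE.
have t0 : t != 0.
  by apply: contra_neq (mulf_neq0 ab0 ac0) => t0; rewrite -tE t0 expr0n mul0r.
exists (fun i => if i == a then t else S a i / t); split; first by rewrite eqxx.
move: abc; rewrite /= !inE negb_or !andbT => /andP[/andP[nab nac] nbc].
have step j : j != a -> j != b -> S a j * S b c = S a c * S b j.
  move=> ja jb; have [->//|jc] := eqVneq j c.
  have -> : S a j * S b c = S a b * S c j.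
    by rewrite [S c j]sym; apply: tet; apply: uniq4 => //; rewrite eq_sym.
  by apply: tet; apply: uniq4 => //; rewrite eq_sym.
(* Multiplying by [S b c] turns [t ^+ 2] into [S a b * S a c] and leaves tetrad identities. Only one
   of [i], [j] can be [b]; [offa] swaps them when it is [j]. *)
have offb i j : i != a -> j != a -> j != b -> i != j -> S a i * S a j = t ^+ 2 * S i j.
  move=> ia ja jb ij; apply: (mulIf bc0).
  rewrite [RHS]mulrAC tE -mulrA step // mulrCA.
  have [->|ib] := eqVneq i b; first by ring.
  rewrite (tet a i b j) ?mulrA 1?[S a c * _]mulrC //.
  by apply: uniq4 => //; rewrite eq_sym.
have offa i j : i != a -> j != a -> i != j -> S a i * S a j = t ^+ 2 * S i j.
  move=> ia ja ij; have [jb|jb] := eqVneq j b; last exact: offb.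
  by rewrite mulrC [S i j]sym; apply: offb => //; rewrite -?jb // eq_sym.
move=> i j ij; case: (eqVneq i a) => [ia|ia]; case: (eqVneq j a) => [ja|ja].
- by rewrite ia ja eqxx in ij.
- by rewrite ia mulrC divfK.
- by rewrite ja divfK // sym.
- by rewrite mulf_div offa // -expr2 mulrAC divff ?mul1r // expf_neq0.
Qed.

Lemma local1_global {R : realFieldType} {p : nat} (S : 'M[R]_p) :
  (forall s : seq 'I_p, (size s <= 4)%N -> exists g, fit1 S s g) ->
  exists g, fit1 S (enum 'I_p) g.
Proof.
move=> H4.
have sym i j : S i j = S j i.
  have [->//|ij] := eqVneq i j.
  have [g [H _]] := H4 [:: i; j] isT.
  by rewrite -!H ?inE ?eqxx ?orbT // 1?eq_sym // mulrC.
have tet : tetrads_vanish S.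
  move=> i j k l; rewrite /= !inE !negb_or => /and4P[/and3P[ij ik il] /andP[jk jl] kl _].
  have [g [H _]] := H4 [:: i; j; k; l] isT.
  by rewrite -!H ?inE ?eqxx ?orbT //; ring.
have [[a [b [c [abc [ab0 [ac0 bc0]]]]]]|notri] := classic (exists a b c : 'I_p,
    uniq [:: a; b; c] /\ S a b != 0 /\ S a c != 0 /\ S b c != 0).
  have := abc; rewrite /= !inE negb_or !andbT => /andP[/andP[nab nac] nbc].
  have [g0 h0] := H4 [:: a; b; c] isT.
  have gaE (g : 'I_p -> R) : fit1 S [:: a; b; c] g -> g a ^+ 2 * S b c = S a b * S a c.
    by move=> [H _]; rewrite -!H ?inE ?eqxx ?orbT //; ring.
  have [||g [ga gE]] := @rank1_loadings _ _ S a b c (g0 a) _ tet abc ab0 ac0 bc0.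
  - by apply/matrixP => i j; rewrite mxE.
  - exact: gaE.
  exists g; split=> [i j _ _|i _]; first exact: gE.
  have [g1 h1] := H4 [:: a; b; c; i] isT.
  (* The triangle fixes the squared loading at [a], and [S a i] then fixes the one at [i], so the
     strict bound at [i] carries over from the local fit [g1]. *)
  have g1a : g1 a ^+ 2 = g a ^+ 2.
    apply: (mulIf bc0); rewrite ga !gaE //.
    by apply: fit1_subset h1 => k; rewrite !inE; do 3![case: (k == _)].
  have [h1E h1lt] := h1.
  suff <- : g1 i ^+ 2 = g i ^+ 2 by apply: h1lt; rewrite !inE eqxx !orbT.
  have [->//|ia] := eqVneq i a.
  have ga0 : g a ^+ 2 != 0.
    by rewrite expf_neq0 //; apply: contraNneq ab0 => g0E; rewrite -gE // g0E mul0r.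
  apply: (mulIf ga0); rewrite -{1}g1a -!exprMn gE // h1E ?inE ?eqxx ?orbT //.
have [[a [b [nab ab0]]]|noedge] := classic (exists a b : 'I_p, a != b /\ S a b != 0);
    last first.
  exists (fun=> 0); split=> [i j _ _ ij|i _].
    rewrite mul0r; have [//|S0] := eqVneq (S i j) 0.
    by case: noedge; exists i, j.
  have [g [_ /(_ i)]] := H4 [:: i] isT; rewrite inE eqxx => /(_ isT).
  by apply: le_lt_trans; rewrite expr0n sqr_ge0.
(* If [S k l] were nonzero, a fit on [a], [b], [k], [l] would have nonzero loadings at [a], [b],
   [k], which would form a triangle. *)
have iso k l : k != a -> k != b -> k != l -> S k l = 0.
  move=> ka kb kl; have [//|kl0] := eqVneq (S k l) 0; case: notri; exists a, b, k.
  have [g [H _]] := H4 [:: a; b; k; l] isT.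
  have : g a * g b != 0 by rewrite H ?inE ?eqxx ?orbT.
  have : g k * g l != 0 by rewrite H ?inE ?eqxx ?orbT.
  rewrite !mulf_eq0 !negb_or => /andP[gk _] /andP[ga gb].
  have nak : a != k by rewrite eq_sym.
  have nbk : b != k by rewrite eq_sym.
  split; first by rewrite /= !inE negb_or nab nak nbk.
  by rewrite -!H ?inE ?eqxx ?orbT // !mulf_neq0.
have [g [H Hlt]] := H4 [:: a; b] isT.
exists (fun k => if k \in [:: a; b] then g k else 0); split=> [i j _ _ ij|i _].
  case: ifPn => [iab|]; last first.
    by rewrite !inE negb_or mul0r => /andP[ia ib]; rewrite iso.
  case: ifPn => [jab|]; first exact: H.
  by rewrite !inE negb_or mulr0 => /andP[ja jb]; rewrite sym iso // eq_sym.
case: ifPn => [iab|_]; first exact: Hlt.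
have [g1 [_ /(_ i)]] := H4 [:: i] isT; rewrite inE eqxx => /(_ isT).
by apply: le_lt_trans; rewrite expr0n sqr_ge0.
Qed.

(** * Two factors with a nonzero tetrad *)

Lemma local2_nonzero_tetrad {R : realFieldType} {p : nat} (S : 'M[R]_p)
    (a b c d : 'I_p) :
  S^T = S ->
  (forall s : seq 'I_p, (size s <= 6)%N -> exists x y, fit2 S s x y) ->
  uniq [:: a; b; c; d] -> S a c * S b d - S a d * S b c != 0 ->
  exists x y, fit2 S (enum 'I_p) x y.
Proof.
move=> /matrixP Ssym H6 + T0.
have sym i j : S i j = S j i by have := Ssym j i; rewrite mxE.
rewrite /= !inE !negb_or => /and4P[/and3P[nab nac nad] /andP[nbc nbd] ncd _].
set T := (X in X != 0) in T0; pose Q := [:: a; b; c; d].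
(* Cramer's rule for the two equations obtained by pairing $v_k = \alpha v_a + \beta v_b$ with $v_c$
   and $v_d$. Its determinant [T] equals $\det(v_a,v_b)\det(v_c,v_d)$ in any fit. *)
pose al k := (S k c * S b d - S k d * S b c) / T.
pose be k := (S a c * S k d - S a d * S k c) / T.
have Qs (s : seq 'I_p) : {subset Q <= Q ++ s} by move=> k kQ; rewrite mem_cat kQ.
have aQ : a \in Q by rewrite inE eqxx.
have bQ : b \in Q by rewrite !inE eqxx orbT.
have cQ : c \in Q by rewrite !inE eqxx !orbT.
have dQ : d \in Q by rewrite !inE eqxx !orbT.
have neqQ e k : e \in Q -> k \notin Q -> e != k.
  by move=> eQ; apply: contraNneq => <-.
(* v_a, v_b is a basis, in which v_k has coordinates computable from S alone *)
have comb s x y k : fit2 S s x y -> {subset Q <= s} -> k \in s -> k \notin Q ->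
    x k = al k * x a + be k * x b /\ y k = al k * y a + be k * y b.
  move=> [H _] sQ ks kQ.
  have [as_ bs cs ds] : [/\ a \in s, b \in s, c \in s & d \in s] by split; apply: sQ.
  have TE : (x a * y b - x b * y a) * (x c * y d - x d * y c) = T.
    by rewrite /T -!H //; ring.
  have kc : k != c by rewrite eq_sym neqQ.
  have kd : k != d by rewrite eq_sym neqQ.
  by split; apply: (mulIf T0); rewrite mulrDl ![_ / T * _ * T]mulrAC !divfK //;
    rewrite -{1}TE -!H //; ring.
(* Pairing the same combination with $v_a$ leaves $|v_a|^2$ as the only quantity not read off from
   [S]; [ipb] does this for $v_b$. *)
have ipa s x y k : fit2 S s x y -> {subset Q <= s} -> k \in s -> k \notin Q ->
    S k a = al k * (x a ^+ 2 + y a ^+ 2) + be k * S a b.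
  move=> h sQ ks kQ; have [xk yk] := comb _ _ _ _ h sQ ks kQ.
  have nk : k != a by rewrite eq_sym neqQ.
  by have [H _] := h; rewrite -!H ?(sQ a) ?(sQ b) // xk yk; ring.
have ipb s x y k : fit2 S s x y -> {subset Q <= s} -> k \in s -> k \notin Q ->
    S k b = be k * (x b ^+ 2 + y b ^+ 2) + al k * S a b.
  move=> h sQ ks kQ; have [xk yk] := comb _ _ _ _ h sQ ks kQ.
  have nk : k != b by rewrite eq_sym neqQ.
  by have [H _] := h; rewrite -!H ?(sQ a) ?(sQ b) // xk yk; ring.
(* A single index i outside Q with nonzero coordinate pins the norm of v_e. *)
have pin e (ca c0 : 'I_p -> R) :
    (forall s x y k, fit2 S s x y -> {subset Q <= s} -> k \in s -> k \notin Q ->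
       S k e = ca k * (x e ^+ 2 + y e ^+ 2) + c0 k) ->
    exists i, forall s x y, fit2 S s x y -> {subset Q <= s} -> i \in s ->
      forall k, k \notin Q -> S k e = ca k * (x e ^+ 2 + y e ^+ 2) + c0 k.
  move=> rel; have [[i [iQ ci]]|none] := classic (exists i, i \notin Q /\ ca i != 0).
    exists i => s x y h sQ si k kQ.
    have [x' [y' h']] := H6 (Q ++ [:: i; k]) isT.
    have [ii ik] : i \in Q ++ [:: i; k] /\ k \in Q ++ [:: i; k].
      by rewrite !mem_cat !inE !eqxx !orbT.
    rewrite (rel _ _ _ _ h' (Qs _) ik kQ); congr (_ * _ + _).
    apply: (mulfI ci); apply: (addIr (c0 i)).
    by rewrite -(rel _ _ _ _ h sQ si iQ) -(rel _ _ _ _ h' (Qs _) ii iQ).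
  (* No coefficient is nonzero, so the relation does not depend on the norm; [a] is a dummy index
     already in [Q]. *)
  exists a => s x y h sQ _ k kQ.
  have [x' [y' h']] := H6 (Q ++ [:: k]) isT.
  have kk : k \in Q ++ [:: k] by rewrite mem_cat inE eqxx orbT.
  rewrite (rel _ _ _ _ h' (Qs _) kk kQ).
  have [->|ck] := eqVneq (ca k) 0; first by rewrite !mul0r.
  by case: none; exists k.
have [i pini] := pin a al (fun k => be k * S a b) ipa.
have [j pinj] := pin b be (fun k => al k * S a b) ipb.
(* This fit has both pinning indices, so its norms of $v_a$ and $v_b$ suit every [k] outside [Q]. *)
have [x [y h]] := H6 (Q ++ [:: i; j]) isT.
have [iin jin] : i \in Q ++ [:: i; j] /\ j \in Q ++ [:: i; j].
  by rewrite !mem_cat !inE !eqxx !orbT.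
have {}pini k : k \notin Q -> S k a = al k * (x a ^+ 2 + y a ^+ 2) + be k * S a b.
  exact: (pini _ _ _ h (Qs _) iin).
have {}pinj k : k \notin Q -> S k b = be k * (x b ^+ 2 + y b ^+ 2) + al k * S a b.
  exact: (pinj _ _ _ h (Qs _) jin).
have {h} [H Hlt] := fit2_subset _ _ _ _ _ (Qs _) h.
pose ext (z : 'I_p -> R) k := if k \in Q then z k else al k * z a + be k * z b.
pose ip k l := ext x k * ext x l + ext y k * ext y l.
have extQ z k : k \in Q -> ext z k = z k by rewrite /ext => ->.
have extC z k : k \notin Q -> ext z k = al k * ext z a + be k * ext z b.
  by move=> kQ; rewrite (extQ _ _ aQ) (extQ _ _ bQ) /ext (negPf kQ).
have ipC k l : k \notin Q -> ip k l = al k * ip a l + be k * ip b l.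
  by move=> kQ; rewrite /ip !(extC _ _ kQ); ring.
have ipS k l : ip k l = ip l k by rewrite /ip; ring.
have ipQ k l : k \in Q -> l \in Q -> k != l -> ip k l = S k l.
  by move=> kQ lQ kl; rewrite /ip !extQ // H.
(* Against [a] and [b] this is the pinned norm relation; against [c] and [d] it is the linear system
   defining [al] and [be]. *)
have ipCQ k e : k \notin Q -> e \in Q -> ip k e = S k e.
  move=> kQ; rewrite ipC // !inE => /or4P[]/eqP->.
  - have nba : b != a by rewrite eq_sym.
    by rewrite (ipQ b a) // (pini k) // /ip !extQ // [S b a]sym; ring.
  - by rewrite (ipQ a b) // (pinj k) // /ip !extQ //; ring.
  - by rewrite !ipQ // /al /be; apply: (mulIf T0); rewrite /T; field.
  - by rewrite !ipQ // /al /be; apply: (mulIf T0); rewrite /T; field.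
have ipCC k l : k \notin Q -> l \notin Q -> ip k l = al k * S a l + be k * S b l.
  by move=> kQ lQ; rewrite ipC // [ip a l]ipS [ip b l]ipS !ipCQ // ![S l _]sym.
(* Products of two extended vectors depend on [S] alone, so they agree with those of a local fit
   containing [k] and [l]. The case [k = l] supplies the diagonal bound. *)
have fitC k l : k \notin Q -> l \notin Q -> exists x y, fit2 S (Q ++ [:: k; l]) x y
    /\ ip k l = x k * x l + y k * y l.
  move=> kQ lQ; have [x' [y' h']] := H6 (Q ++ [:: k; l]) isT.
  exists x', y'; split=> //; rewrite ipCC //.
  have kkl : k \in Q ++ [:: k; l] by rewrite mem_cat !inE eqxx !orbT.
  have lkl : l \in Q ++ [:: k; l] by rewrite mem_cat !inE eqxx !orbT.
  have [xk yk] := comb _ _ _ k h' (Qs _) kkl kQ.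
  have [H' _] := h'.
  rewrite -(H' _ _ (Qs _ _ aQ) lkl (neqQ _ _ aQ lQ)).
  rewrite -(H' _ _ (Qs _ _ bQ) lkl (neqQ _ _ bQ lQ)).
  by rewrite xk yk; ring.
exists (ext x), (ext y); split=> [k l _ _ kl|k _].
  change (ip k l = S k l).
  have [kQ|kQ] := boolP (k \in Q); have [lQ|lQ] := boolP (l \in Q).
  - exact: ipQ.
  - by rewrite ipS ipCQ // sym.
  - exact: ipCQ.
  have [x' [y' [[H' _] ->]]] := fitC k l kQ lQ.
  by rewrite H' // mem_cat !inE eqxx !orbT.
rewrite !expr2; change (ip k k < S k k).
have [kQ|kQ] := boolP (k \in Q).
  by rewrite /ip !extQ // -!expr2 Hlt.
have [x' [y' [[_ Hlt'] ->]]] := fitC k k kQ kQ.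
by rewrite -!expr2 Hlt' // mem_cat !inE eqxx !orbT.
Qed.

(** * Two factors with all tetrads zero *)

(** In a plane fit a tetrad is a product of two determinants, such as $\det(v_a,v_b)\det(v_c,v_d)$,
    so one vector pair in each product is parallel. The pair found avoids [a], which makes [a], [u],
    [v] a triangle usable for one-factor loadings. *)
Lemma parallel_pair {R : realFieldType} {p : nat} (S : 'M[R]_p) (s : seq 'I_p)
    (x y : 'I_p -> R) (a b c d : 'I_p) :
  S^T = S -> tetrads_vanish S -> fit2 S s x y -> {subset [:: a; b; c; d] <= s} ->
  uniq [:: a; b; c; d] -> S a b != 0 -> S c d != 0 ->
  exists u v, [/\ u \in [:: b; c; d], v \in [:: b; c; d], u != v,
                  [&& S a u != 0, S a v != 0 & S u v != 0] & x u * y v = x v * y u].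
Proof.
move=> /matrixP Ssym tet [H _] sQ abcd ab0 cd0.
have sym i j : S i j = S j i by have := Ssym j i; rewrite mxE.
have := abcd; rewrite /= !inE !negb_or => /and4P[/and3P[nab nac nad] /andP[nbc nbd] ncd _].
have t1 := tet a b c d abcd.
have t2 : S a b * S c d = S a d * S b c.
  by rewrite [S c d]sym; apply: tet; apply: uniq4 => //; rewrite eq_sym.
have abcd0 := mulf_neq0 ab0 cd0.
have /andP[ac0 bd0] : (S a c != 0) && (S b d != 0) by rewrite -negb_or -mulf_eq0 -t1.
have /andP[ad0 bc0] : (S a d != 0) && (S b c != 0) by rewrite -negb_or -mulf_eq0 -t2.
have [aS bS cS dS] : [/\ a \in s, b \in s, c \in s & d \in s].
  by split; apply: sQ; rewrite !inE eqxx ?orbT.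
have [bc|bc] := eqVneq (x b * y c) (x c * y b).
  by exists b, c; split; rewrite ?inE ?eqxx ?orbT ?ab0 ?ac0 ?ad0 ?bc0 ?bd0.
have [bd|bd] := eqVneq (x b * y d) (x d * y b).
  by exists b, d; split; rewrite ?inE ?eqxx ?orbT ?ab0 ?ac0 ?ad0 ?bc0 ?bd0.
have [cd|cd] := eqVneq (x c * y d) (x d * y c).
  by exists c, d; split; rewrite ?inE ?eqxx ?orbT ?ab0 ?ac0 ?ad0 ?bc0 ?bd0.
(* Otherwise a is parallel to b and to c, which are independent, so v_a = 0. *)
have /eqP : (x a * y b - x b * y a) * (x c * y d - x d * y c) = 0.
  by rewrite -(subrr (S a b * S c d)) {1}t1 t2 -!H //; ring.
rewrite mulf_eq0 [X in _ || X]subr_eq0 (negPf cd) orbF => /eqP ab.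
have /eqP : (x a * y c - x c * y a) * (x b * y d - x d * y b) = 0.
  by rewrite -(subrr (S a b * S c d)) {2}t2 -!H //; ring.
rewrite mulf_eq0 [X in _ || X]subr_eq0 (negPf bd) orbF => /eqP ac.
move: bc; rewrite -subr_eq0 => bc.
have xa : x a = 0.
  apply: (mulIf bc); rewrite mul0r.
  have -> : x a * (x b * y c - x c * y b) =
    x b * (x a * y c - x c * y a) - x c * (x a * y b - x b * y a) by ring.
  by rewrite ab ac !mulr0 subrr.
have ya : y a = 0.
  apply: (mulIf bc); rewrite mul0r.
  have -> : y a * (x b * y c - x c * y b) =
    y b * (x a * y c - x c * y a) - y c * (x a * y b - x b * y a) by ring.
  by rewrite ab ac !mulr0 subrr.
by case/eqP: ab0; rewrite -H // xa ya !mul0r addr0.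
Qed.

(** For parallel $v_u$, $v_v$ the product is $\langle v_i,v_v\rangle^2|v_u|^2$, and the gap to the
    upper bound is $\det(v_i,v_v)^2|v_u|^2$. After division by $\langle v_u,v_v\rangle^2$, when
    nonzero, this bounds a squared one-factor loading by $|v_i|^2$. *)
Lemma parallel_inner {R : realFieldType} (xi yi xu yu xv yv : R) :
  xu * yv = xv * yu ->
  0 <= (xi * xu + yi * yu) * (xi * xv + yi * yv) * (xu * xv + yu * yv)
    <= (xi ^+ 2 + yi ^+ 2) * (xu * xv + yu * yv) ^+ 2.
Proof.
move=> uv.
have -> : (xi * xu + yi * yu) * (xi * xv + yi * yv) * (xu * xv + yu * yv) =
    (xi * xv + yi * yv) ^+ 2 * (xu ^+ 2 + yu ^+ 2).
  by ring: uv.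
have -> : (xi ^+ 2 + yi ^+ 2) * (xu * xv + yu * yv) ^+ 2 =
    (xi * xv + yi * yv) ^+ 2 * (xu ^+ 2 + yu ^+ 2) +
    (xi * yv - xv * yi) ^+ 2 * (xu ^+ 2 + yu ^+ 2).
  by ring: uv.
have u2 : 0 <= xu ^+ 2 + yu ^+ 2 by rewrite addr_ge0 ?sqr_ge0.
by rewrite lerDl; apply/andP; split; rewrite mulr_ge0 ?sqr_ge0.
Qed.

Lemma disjoint_edges_rank1 {R : rcfType} {p : nat} (S : 'M[R]_p) (a b c d : 'I_p) :
  S^T = S -> tetrads_vanish S ->
  (forall s : seq 'I_p, (size s <= 6)%N -> exists x y, fit2 S s x y) ->
  uniq [:: a; b; c; d] -> S a b != 0 -> S c d != 0 ->
  exists g, fit1 S (enum 'I_p) g.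
Proof.
move=> Ssym tet H6 abcd ab0 cd0.
have sym i j : S i j = S j i by have /matrixP/(_ j i) := Ssym; rewrite mxE.
have pair i : exists s x y u v, [/\ fit2 S s x y, [/\ i \in s, u \in s & v \in s],
    uniq [:: i; u; v], S u v != 0 & x u * y v = x v * y u].
  (* Relabelling the two edges keeps [i] out of the last three positions, where the parallel pair
     will lie; [i] may coincide with [a']. *)
  have [a' [b' [c' [d' [abcd' ab0' cd0' iN]]]]] : exists a b c d,
      [/\ uniq [:: a; b; c; d], S a b != 0, S c d != 0 & i \notin [:: b; c; d]].
    have := abcd; rewrite /= !inE !negb_or.
    move=> /and4P[/and3P[nab nac nad] /andP[nbc nbd] ncd _].
    have [->|ib] := eqVneq i b.
      exists b, a, c, d; rewrite sym; split=> //.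
        by apply: uniq4 => //; rewrite eq_sym.
      by rewrite !inE !negb_or eq_sym nab nbc.
    have [->|ic] := eqVneq i c.
      exists c, d, a, b; split=> //; first by apply: uniq4 => //; rewrite eq_sym.
      by rewrite !inE !negb_or ncd eq_sym nac eq_sym nbc.
    have [->|id] := eqVneq i d.
      exists d, c, a, b; rewrite [S d c]sym; split=> //.
        by apply: uniq4 => //; rewrite eq_sym.
      by rewrite !inE !negb_or eq_sym ncd eq_sym nad eq_sym nbd.
    by exists a, b, c, d; split=> //; rewrite !inE !negb_or ib ic id.
  have [x [y h]] := H6 [:: i; a'; b'; c'; d'] isT.
  have sub : {subset [:: a'; b'; c'; d'] <= [:: i; a'; b'; c'; d']}.
    by move=> k kQ; rewrite inE kQ orbT.
  have [u [v [uQ vQ uv /and3P[_ _ uv0] par]]] :=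
    parallel_pair _ _ _ _ _ _ _ _ Ssym tet h sub abcd' ab0' cd0'.
  exists [:: i; a'; b'; c'; d'], x, y, u, v; split=> //.
    by rewrite inE eqxx !sub // inE ?uQ ?vQ orbT.
  rewrite /= !inE negb_or uv !andbT.
  by apply/andP; split; apply: contraNneq iN => ->.
have prod_bounds (s : seq 'I_p) x y i u v : fit2 S s x y -> i \in s -> u \in s -> v \in s ->
    uniq [:: i; u; v] -> x u * y v = x v * y u ->
    0 <= S i u * S i v * S u v <= (x i ^+ 2 + y i ^+ 2) * S u v ^+ 2.
  move=> [H _] si su sv; rewrite /= !inE negb_or !andbT => /andP[/andP[iu iv] uv] par.
  by rewrite -!H //; apply: parallel_inner.
have [x [y h]] := H6 [:: a; b; c; d] isT.
have sub : {subset [:: a; b; c; d] <= [:: a; b; c; d]} by [].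
have [u [v [uQ vQ uv /and3P[au0 av0 uv0] par]]] :=
  parallel_pair _ _ _ _ _ _ _ _ Ssym tet h sub abcd ab0 cd0.
have auv : uniq [:: a; u; v].
  rewrite /= !inE negb_or uv !andbT.
  move: abcd; rewrite cons_uniq => /andP[aN _].
  by apply/andP; split; apply: contraNneq aN => ->.
have /andP[nonneg _] : 0 <= S a u * S a v * S u v
    <= (x a ^+ 2 + y a ^+ 2) * S u v ^+ 2.
  by apply: prod_bounds h _ _ _ auv par; rewrite inE ?uQ ?vQ ?eqxx ?orbT.
(* The loading at [a] is forced up to sign; the parallel pair makes the radicand nonnegative. *)
have t2 : Num.sqrt (S a u * S a v / S u v) ^+ 2 * S u v = S a u * S a v.
  rewrite sqr_sqrtr ?divfK //.
  have -> : S a u * S a v / S u v = S a u * S a v * S u v / S u v ^+ 2 by field.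
  by rewrite divr_ge0 ?sqr_ge0.
have [g [_ gE]] := rank1_loadings _ _ _ _ _ Ssym tet auv au0 av0 uv0 t2.
exists g; split=> [i j _ _|i _]; first exact: gE.
have [s [x' [y' [u' [v' [h' [si su sv] iuv uv0' par']]]]]] := pair i.
have [_ Hlt] := h'; apply: le_lt_trans (Hlt i si).
have /andP[_ le1] := prod_bounds _ _ _ _ _ _ h' si su sv iuv par'.
move: iuv; rewrite /= !inE negb_or !andbT => /andP[/andP[iu iv] uv'].
have pos : 0 < S u' v' ^+ 2 by rewrite exprn_even_gt0.
(* Scaled by [S u' v' ^+ 2], the squared loading at [i] becomes [S i u' * S i v' * S u' v'], which
   [le1] bounds. *)
rewrite -(ler_pM2r pos); apply: le_trans le1.
by rewrite -!gE // le_eqVlt; apply/orP; left; apply/eqP; ring.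
Qed.

Lemma local2_tetrads_vanish {R : rcfType} {p : nat} (S : 'M[R]_p) :
  S^T = S -> tetrads_vanish S ->
  (forall s : seq 'I_p, (size s <= 6)%N -> exists x y, fit2 S s x y) ->
  exists x y, fit2 S (enum 'I_p) x y.
Proof.
move=> Ssym tet H6.
have sym i j : S i j = S j i by have /matrixP/(_ j i) := Ssym; rewrite mxE.
have [[a [b [c [d [abcd ab0 cd0]]]]]|nodis] := classic (exists a b c d,
    [/\ uniq [:: a; b; c; d], S a b != 0 & S c d != 0]).
  have [g [gE glt]] := disjoint_edges_rank1 _ _ _ _ _ Ssym tet H6 abcd ab0 cd0.
  exists g, (fun=> 0); split=> [i j Ai Aj ij|i Ai]; first by rewrite mul0r addr0 gE.
  by rewrite expr0n addr0 glt.
have {}nodis i j k l : i != j -> S i j != 0 -> k != l -> S k l != 0 ->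
    (k \in [:: i; j]) || (l \in [:: i; j]).
  move=> ij ij0 kl kl0; apply/negPn/negP; rewrite negb_or !inE !negb_or.
  move=> /andP[/andP[ki kj] /andP[li lj]]; apply: nodis; exists i, j, k, l; split=> //.
  by apply: uniq4 => //; rewrite eq_sym.
(* Without two disjoint edges the nonzero pattern is a triangle or a star, and a star
   has at most two leaves since they carry pairwise orthogonal nonzero plane vectors. *)
suff [s [sz iso]] : exists s : seq 'I_p, (size s <= 6)%N /\
    forall i j, i \notin s -> i != j -> S i j = 0.
  have [x [y [H Hlt]]] := H6 s sz.
  exists (fun k => if k \in s then x k else 0), (fun k => if k \in s then y k else 0).
  split=> [i j _ _ ij|i _].
    have [si|si] := boolP (i \in s); last by rewrite !mul0r addr0 iso.
    have [sj|sj] := boolP (j \in s); first exact: H.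
    by rewrite !mulr0 addr0 sym iso // eq_sym.
  have [si|si] := boolP (i \in s); first exact: Hlt.
  have [x' [y' [_ /(_ i)]]] := H6 [:: i] isT; rewrite inE eqxx => /(_ isT).
  by apply: le_lt_trans; rewrite expr0n addr0 addr_ge0 ?sqr_ge0.
have [[a [b [c [abc ab0 ac0]]]]|nopath] := classic (exists a b c,
    [/\ uniq [:: a; b; c], S a b != 0 & S a c != 0]); last first.
  have [[a [b [ab ab0]]]|noedge] := classic (exists a b, a != b /\ S a b != 0); last first.
    exists [::]; split=> // i j _ ij; have [//|ij0] := eqVneq (S i j) 0.
    by case: noedge; exists i, j.
  exists [:: a; b]; split=> // i j iN ij; have [//|ij0] := eqVneq (S i j) 0.
  case: nopath; have := nodis _ _ _ _ ab ab0 ij ij0; rewrite (negPf iN) /= !inE.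
  move: iN; rewrite !inE negb_or => /andP[ia ib] /orP[]/eqP jE.
    exists a, b, i; rewrite -jE [S j i]sym; split=> //.
      by rewrite /= !inE negb_or jE ab eq_sym ia eq_sym ib.
    by rewrite jE.
  exists b, a, i; rewrite -jE [S j i]sym; split=> //.
    by rewrite /= !inE negb_or jE eq_sym ab eq_sym ib eq_sym ia.
  by rewrite jE sym.
move: abc; rewrite /= !inE negb_or !andbT => /andP[/andP[nab nac] nbc].
exists [:: a; b; c]; split=> // i j iN ij; have [//|ij0] := eqVneq (S i j) 0.
move: iN; rewrite !inE !negb_or => /and3P[ia ib ic].
(* The edge must meet both [a b] and [a c] but avoids them at [i], so [j] is the common vertex and
   [i] a third leaf of the star at [a]. *)
have ja : j = a.
  have := nodis _ _ _ _ nab ab0 ij ij0; have := nodis _ _ _ _ nac ac0 ij ij0.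
  rewrite !inE (negPf ia) (negPf ib) (negPf ic) /=.
  by case: eqVneq => //= _ /eqP-> /eqP cb; rewrite cb eqxx in nbc.
move: ij ij0; rewrite ja sym => _ ai0.
have [nai nbi nci] : [/\ a != i, b != i & c != i] by split; rewrite eq_sym.
have ortho k l m : a != m -> S a m != 0 -> k != l ->
    k \notin [:: a; m] -> l \notin [:: a; m] -> S k l = 0.
  move=> am am0 kl kN lN; have [//|kl0] := eqVneq (S k l) 0.
  by have := nodis _ _ _ _ am am0 kl kl0; rewrite (negPf kN) (negPf lN).
have bc0 : S b c = 0.
  by apply: (ortho b c i) => //; rewrite !inE negb_or eq_sym ?nab ?nac.
have bi0 : S b i = 0.
  by apply: (ortho b i c) => //; rewrite !inE negb_or eq_sym ?nab ?nai // eq_sym.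
have ci0 : S c i = 0.
  by apply: (ortho c i b) => //; rewrite !inE negb_or eq_sym ?nac ?nai // eq_sym.
have [x [y [H _]]] := H6 [:: a; b; c; i] isT.
have [aS bS cS iS] : [/\ a \in [:: a; b; c; i], b \in [:: a; b; c; i],
    c \in [:: a; b; c; i] & i \in [:: a; b; c; i]] by rewrite !inE !eqxx !orbT.
pose N k := x k ^+ 2 + y k ^+ 2.
have N0 k : k \in [:: a; b; c; i] -> a != k -> S a k != 0 -> N k != 0.
  move=> ks ak; apply: contraNneq => /eqP; rewrite paddr_eq0 ?sqr_ge0 // !sqrf_eq0.
  by move=> /andP[/eqP xk /eqP yk]; rewrite -H // xk yk !mulr0 addr0.
(* Three nonzero, pairwise orthogonal plane vectors cannot exist: the product of norms below is
   nonzero, yet Lagrange's identity and $\det(v_b,v_c)\det(v_b,v_i)=\langle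
   v_c,v_i\rangle|v_b|^2-\langle v_b,v_c\rangle\langle v_b,v_i\rangle$ make it zero. *)
have := mulf_neq0 (mulf_neq0 (N0 _ bS nab ab0) (N0 _ cS nac ac0))
                  (mulf_neq0 (N0 _ bS nab ab0) (N0 _ iS nai ai0)).
have -> : N b * N c * (N b * N i) =
    (S b c ^+ 2 + (x b * y c - x c * y b) ^+ 2) *
    (S b i ^+ 2 + (x b * y i - x i * y b) ^+ 2) by rewrite -!H // /N; ring.
rewrite bc0 bi0 expr0n !add0r -exprMn.
have -> : (x b * y c - x c * y b) * (x b * y i - x i * y b) =
    S c i * N b - S b c * S b i by rewrite -!H // /N; ring.
by rewrite ci0 bc0 !mul0r subrr expr0n eqxx.
Qed.

(** * From local fits to the equivalence *)

Lemma local2_global {R : rcfType} {p : nat} (S : 'M[R]_p) :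
  S^T = S -> (forall s : seq 'I_p, (size s <= 6)%N -> exists x y, fit2 S s x y) ->
  exists x y, fit2 S (enum 'I_p) x y.
Proof.
move=> Ssym H6.
have [tet|] := classic (tetrads_vanish S); first exact: local2_tetrads_vanish.
move=> ntet; apply: NNPP => nofit; apply: ntet => i j k l ijkl; apply/eqP/negPn/negP => T0.
(* In the order [i], [l], [j], [k] the determinant [T] becomes the tetrad that failed to vanish. *)
apply: nofit; apply: (local2_nonzero_tetrad S i l j k) => //.
  rewrite -(perm_uniq (_ : perm_eq [:: i; j; k; l] _)) //.
  by rewrite perm_cons (_ : [:: j; k; l] = rot 1 [:: l; j; k]) // perm_rot.
have sym u v : S u v = S v u by have /matrixP/(_ v u) := Ssym; rewrite mxE.
by rewrite subr_eq0 [S l k]sym [S l j]sym.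
Qed.

Lemma inF_principal_sub {R : realFieldType} {p k : nat} (m : nat) (S : 'M[R]_p)
    (f : 'I_k -> 'I_p) :
  strictly_incr f -> inF m S -> inF m (principal_sub f S).
Proof.
move=> /strictly_incr_inj finj /inF_gram[G [H1 H2]]; apply/(inF_sub_gram m S f finj).
by exists G; split=> [i j _ _|i _]; [apply: H1|apply: H2]; rewrite mem_enum.
Qed.

Theorem theorem3 (R : rcfType) (p : nat) (S : 'M[R]_p) :
  (6 <= p)%N -> posdef S ->
  ((inF 2 S /\ ~ inF 1 S) <->
   ((forall f : 'I_6 -> 'I_p, strictly_incr f -> inF 2 (principal_sub f S)) /\
    (exists f : 'I_4 -> 'I_p, strictly_incr f /\ ~ inF 1 (principal_sub f S)))).
Proof.
move=> p6 [Ssym _]; split=> [[F2 nF1]|[loc2 [f [fi nF1]]]].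
  split=> [f fi|]; first exact: inF_principal_sub.
  apply: NNPP => nof; apply: nF1; apply/inF_gram/fit1_gram/local1_global => s sz.
  have [f [fi sf]] := strictly_incr_cover _ _ _ sz (leq_trans (isT : (4 <= 6)%N) p6).
  have F1 : inF 1 (principal_sub f S) by apply: NNPP => nF1; apply: nof; exists f.
  move/(inF_sub_gram _ _ _ (strictly_incr_inj _ _ _ fi))/fit1_gram: F1 => [g hg].
  by exists g; apply: fit1_subset hg.
split; last by move=> F1; apply: nF1; apply: inF_principal_sub.
apply/inF_gram/fit2_gram/local2_global => // s sz.
have [h [hi sh]] := strictly_incr_cover _ _ _ sz p6.
move/(inF_sub_gram _ _ _ (strictly_incr_inj _ _ _ hi))/fit2_gram: (loc2 h hi) => [x [y hxy]].
by exists x, y; apply: fit2_subset hxy.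
Qed.
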